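(* In the setting of the context, there is a constant $j_*$ depending only on the geometric data (including the chosen $x_{\{i,k\}}$) such that for every supersymmetric configuration with $j_I\ge j_*$ for all $I=0,\dots,p$ and for all $i\in\{1,\dots,p\}$, $$n_i^{D5}<\frac{6T_0}{\min(x_{\{i,k\}})}+T_i,$$ where the minimum is taken over all pairs of distinct indices in $\{1,\dots,p\}$.
   Context: Geometry. $B$ is a smooth projective complex surface, $\pi:X\to B$ is a smooth elliptically fibered Calabi--Yau threefold with a single section $\sigma$, so $\sigma^2=-c_1\sigma$ and $H^{1,1}(X)$ is spanned by $\sigma$ and $\pi^*H^{1,1}(B)$; $c_1,c_2$ are the Chern classes of $B$. Let $D_1,\dots,D_p\in H^2(B,\mathbb{Z})$, $p=h^{1,1}(B)\ge2$, be linearly independent classes generating the Kähler cone of $B$ or a simplicial subcone; their pullbacks to $X$ are denoted by the same symbols, and $D_0=\sigma+\pi^*c_1$. Let $C$ be the intersection form on $H^{1,1}(B)$, $C_{ij}=D_i\cdot D_j$. Write $c_1=\sum_i b_iD_i$, $b=(b_i)$, $\mathcal K_{00i}=\sum_j b_jC_{ij}$, $\mathcal K_{000}=\sum_{i,j} b_ib_jC_{ij}$. The triple intersection form $\mathcal K$ on $X$ is the symmetric trilinear form with $\mathcal K(D_i,D_j,D_k)=0$, $\mathcal K(D_0,D_i,D_j)=C_{ij}$, $\mathcal K(D_0,D_0,D_i)=\mathcal K_{00i}$, $\mathcal K(D_0,D_0,D_0)=\mathcal K_{000}$. Put $T_0=\int_B(c_2+11c_1^2)$ and $T_i=12\,\mathcal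 K_{00i}$. Assume: (1) all $D_i$ are time-like or light-like for $C$ ($C(D_i,D_i)\ge0$) and lie in the same closed light-cone; (2) $b_i\ge 0$ for all $i$; (3) every $\mathcal K_{00i}$ is a positive integer; (4) $C$ has signature $(1,p-1)$. For each pair $\{i,k\}$, $i\ne k$, fix a positive rational number $x_{\{i,k\}}$ such that the matrix $(M_{\{i,k\}})_{jl}=x_{\{i,k\}}C_{ij}C_{kl}+x_{\{i,k\}}C_{il}C_{kj}-C_{jl}$ is positive semi-definite (such numbers exist under (1), (4)). Supersymmetric configuration: a finite collection of D9-brane stacks $\alpha$, each with a positive integer $N^\alpha$ and a flux $F^\alpha=m_0^\alpha D_0+\sum_{i}m_i^\alpha D_i\in H^2(X,\mathbb{Z})$ ($m_I^\alpha\in\mathbb{Q}$, $m_0^\alpha\in\mathbb{Z}$, $\sum_jC_{ij}m_j^\alpha\in\mathbb{Z}$), non-negative integers $n^{D5}_0,\dots,n^{D5}_p$ (numbers of D5-branes), and a real Kähler class $J=j_0D_0+\sum_ij_iD_i$ with $j_I>0$, such that: $n^{D5}_I-T_I=\sum_\alpha N^\alpha\mathcal K(F^\alpha,F^\alpha,D_I)$ for $I=0,\dots,p$; $\sum_\alpha N^\alpha=16$; and for each $\alpha$, $3\mathcal K(J,J,F^\alpha)=\mathcal K(F^\alpha,F^\alpha,F^\alpha)$ and $\mathcal K(J,J,J)>3\mathcal K(J,F^\alpha,F^\alpha)$. *)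

(* Defs.v *)
(* MathComp, with the real numbers given by an abstract R : realType of
   MathComp-Analysis. *)
From HB Require Import structures.
From mathcomp Require Import all_boot all_order all_algebra.
From mathcomp Require Import reals.

Set Implicit Arguments.
Unset Strict Implicit.
Unset Printing Implicit Defensive.

Import Order.TTheory GRing.Theory Num.Theory.
Local Open Scope ring_scope.

(** * Symmetric bilinear forms, in coordinates *)

Definition bform (S : pzRingType) (n : nat) (A : 'M[S]_n) (u v : 'rV[S]_n) : S :=
  (u *m A *m v^T) 0 0.

Definition psd (S : numDomainType) (n : nat) (A : 'M[S]_n) : Prop :=
  A^T = A /\ forall v : 'rV[S]_n, 0 <= bform A v v.

(* Signature (r, s) of a nondegenerate form, by Sylvester's law of inertia. *)
Definition has_signature (R : realType) (n : nat) (A : 'M[R]_n) (r s : nat) : Prop :=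
  (r + s)%N = n /\
  exists2 P : 'M[R]_n, P \in unitmx &
    P *m A *m P^T = diag_mx (\row_(i < n) (if (i < r)%N then 1 else -1)).

(* The closed light-cone of A containing the time-like vector t; for A of
   signature (1, n-1) the vectors v with A(v, v) >= 0 form two such cones,
   those of t and of - t. *)
Definition in_closed_light_cone (R : realType) (n : nat) (A : 'M[R]_n)
    (t v : 'rV[R]_n) : Prop :=
  0 <= bform A v v /\ 0 <= bform A t v.

(** * Numerical data of the elliptic fibration X -> B *)

(* H^{1,1}(B) is given the basis D_1, ..., D_p, here indexed by 'I_p, so that
   D_i is the i-th unit vector. *)
Record base_data (p : nat) := BaseData {
  Cmat : 'M[int]_p;    (* C_ij = D_i . D_j *)
  bvec : 'rV[rat]_p;   (* c_1(B) = \sum_i b_i D_i *)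
  chern2 : int         (* \int_B c_2(B) *)
}.

Definition Cq (p : nat) (B : base_data p) (i j : 'I_p) : rat := (Cmat B i j)%:~R.

Definition Cr (R : realType) (p : nat) (B : base_data p) : 'M[R]_p :=
  map_mx intr (Cmat B).

Definition K00 (p : nat) (B : base_data p) (i : 'I_p) : rat :=
  \sum_j bvec B 0 j * Cq B i j.

Definition K000 (p : nat) (B : base_data p) : rat :=
  \sum_i \sum_j bvec B 0 i * bvec B 0 j * Cq B i j.

(* H^{1,1}(X) has the basis D_0, D_1, ..., D_p, indexed by 'I_p.+1: the index
   ord0 stands for D_0 = sigma + pi^* c_1 and lift ord0 i for the pullback of
   the class D_i of B. *)
Definition divisor (S : pzSemiRingType) (p : nat) (I : 'I_p.+1) : 'rV[S]_p.+1 :=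
  delta_mx 0 I.

Definition intersection_number (p : nat) (B : base_data p)
    (I J L : 'I_p.+1) : rat :=
  match unlift ord0 I, unlift ord0 J, unlift ord0 L with
  | None, None, None => K000 B
  | Some i, None, None | None, Some i, None | None, None, Some i => K00 B i
  | Some i, Some j, None | Some i, None, Some j | None, Some i, Some j => Cq B i j
  | Some _, Some _, Some _ => 0
  end.

Definition trilinear (S : pzRingType) (n : nat) (k : 'I_n -> 'I_n -> 'I_n -> S)
    (u v w : 'rV[S]_n) : S :=
  \sum_I \sum_J \sum_L u 0 I * v 0 J * w 0 L * k I J L.

(* The triple intersection form on rational, resp. real, classes. *)
Definition Kq (p : nat) (B : base_data p) : 'rV[rat]_p.+1 -> 'rV[rat]_p.+1 ->
    'rV[rat]_p.+1 -> rat :=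
  trilinear (intersection_number B).

Definition Kr (R : realType) (p : nat) (B : base_data p) : 'rV[R]_p.+1 ->
    'rV[R]_p.+1 -> 'rV[R]_p.+1 -> R :=
  trilinear (fun I J L => ratr (intersection_number B I J L)).

Definition T (p : nat) (B : base_data p) (I : 'I_p.+1) : rat :=
  match unlift ord0 I with
  | None => (chern2 B)%:~R + 11 * K000 B
  | Some i => 12 * K00 B i
  end.

(* The number \int_B c_2(B) is the Euler number
   2 - 4 h^{1,0} + 2 h^{2,0} + h^{1,1} of B. By the remaining conditions and the
   nefness of the D_i, the class c_1 = - K_B is nef with positive square, so B
   is rational, h^{1,0} = h^{2,0} = 0, and p = h^{1,1}(B) gives euler_number. *)
Record geometric (R : realType) (p : nat) (B : base_data p) : Prop := Geometric {
  C_sym : (Cmat B)^T = Cmat B;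
  euler_number : chern2 B = (p + 2)%:Z;
  same_light_cone : exists2 t : 'rV[R]_p, 0 < bform (Cr R B) t t &
    forall i : 'I_p, in_closed_light_cone (Cr R B) t (delta_mx 0 i);
  b_ge0 : forall i, 0 <= bvec B 0 i;
  K00_int : forall i, K00 B i \is a Num.int;
  K00_gt0 : forall i, 0 < K00 B i;
  C_signature : has_signature (Cr R B) 1 p.-1
}.

(** * The numbers x_{i,k} *)

Definition Mpair (p : nat) (B : base_data p) (x : {set 'I_p} -> rat)
    (i k : 'I_p) : 'M[rat]_p :=
  \matrix_(j, l) (x [set i; k] * Cq B i j * Cq B k l
                  + x [set i; k] * Cq B i l * Cq B k j - Cq B j l).

(* Only the values of x on two-element sets matter. *)
Definition admissible (R : realType) (p : nat) (B : base_data p)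
    (x : {set 'I_p} -> rat) : Prop :=
  forall i k : 'I_p, i != k ->
    0 < x [set i; k] /\ psd (map_mx ratr (Mpair B x i k) : 'M[R]_p).

Definition pair_values (p : nat) (x : {set 'I_p} -> rat) : seq rat :=
  [seq x A | A <- enum [set A : {set 'I_p} | #|A| == 2%N]].

(* The default 0 is irrelevant for p >= 2: see pair_minP. *)
Definition pair_min (p : nat) (x : {set 'I_p} -> rat) : rat :=
  \big[Num.min/head 0 (pair_values x)]_(y <- pair_values x) y.

Lemma pair_minP (p : nat) (x : {set 'I_p} -> rat) : (2 <= p)%N ->
  (exists i k : 'I_p, i != k /\ pair_min x = x [set i; k]) /\
  (forall i k : 'I_p, i != k -> pair_min x <= x [set i; k]).
Proof.
move=> p2.
have memP y : reflect (exists i k : 'I_p, i != k /\ y = x [set i; k])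
                      (y \in pair_values x).
  apply: (iffP mapP) => [[A]|[i [k [ik ->]]]].
    rewrite mem_enum inE => /cards2P [i [k [ik defA]]] ->.
    by exists i, k; rewrite -defA.
  by exists [set i; k]; rewrite // mem_enum inE cards2 ik.
have bigmin_in (s : seq rat) h : \big[Num.min/h]_(y <- s) y \in h :: s.
  elim: s => [|a s IHs]; first by rewrite big_nil mem_head.
  rewrite big_cons !inE minEle; case: ifP => _; first by rewrite eqxx orbT.
  by move: IHs; rewrite inE => /orP [->|->]; rewrite ?orbT.
have bigmin_le (s : seq rat) h y : y \in s -> \big[Num.min/h]_(z <- s) z <= y.
  elim: s => // a s IHs; rewrite big_cons inE ge_min => /orP [/eqP ->|/IHs ->].
    by rewrite lexx.
  by rewrite orbT.
split=> [|i k ik]; last by apply/bigmin_le/memP; exists i, k.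
apply/memP; have : pair_min x \in head 0 (pair_values x) :: pair_values x.
  exact: bigmin_in.
have : x [set Ordinal (ltnW p2); Ordinal p2] \in pair_values x.
  by apply/memP; exists (Ordinal (ltnW p2)), (Ordinal p2).
case: (pair_values x) => [//|a s] _ /=; rewrite inE => /orP [/eqP ->|//].
exact: mem_head.
Qed.

(** * Supersymmetric configurations *)

(* F = m_0 D_0 + \sum_i m_i D_i lies in H^2(X, Z). *)
Definition integral_flux (p : nat) (B : base_data p) (F : 'rV[rat]_p.+1) : Prop :=
  F 0 ord0 \is a Num.int /\
  forall i : 'I_p, \sum_j Cq B i j * F 0 (lift ord0 j) \is a Num.int.

Record configuration (R : realType) (p : nat) := Configuration {
  nstacks : nat;
  ND9 : 'I_nstacks -> nat;
  flux : 'I_nstacks -> 'rV[rat]_p.+1;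
  nD5 : 'I_p.+1 -> nat;
  kahler : 'rV[R]_p.+1
}.

Definition fluxr (R : realType) (p : nat) (c : configuration R p)
    (a : 'I_(nstacks c)) : 'rV[R]_p.+1 := map_mx ratr (flux a).

Record supersymmetric (R : realType) (p : nat) (B : base_data p)
    (c : configuration R p) : Prop := Supersymmetric {
  ND9_gt0 : forall a : 'I_(nstacks c), (0 < ND9 a)%N;
  flux_int : forall a : 'I_(nstacks c), integral_flux B (flux a);
  kahler_gt0 : forall I, 0 < kahler c 0 I;
  D5_tadpole : forall I, (nD5 c I)%:R - T B I
    = \sum_a (ND9 a)%:R * Kq B (@flux _ _ c a) (flux a) (divisor rat I);
  D9_tadpole : (\sum_a @ND9 _ _ c a)%N = 16%N;
  susy_eq : forall a : 'I_(nstacks c),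
    3 * Kr B (kahler c) (kahler c) (fluxr a) = Kr B (fluxr a) (fluxr a) (fluxr a);
  susy_lt : forall a : 'I_(nstacks c),
    3 * Kr B (kahler c) (fluxr a) (fluxr a) < Kr B (kahler c) (kahler c) (kahler c)
}.

(* Main.v *)
(* Write u = j + (j_0/2) c_1 and, for a stack with flux m D_0 + f, m <> 0,
   y = f/m + c_1. The flux numbers are K(F,F,D_0) = m^2 y.y and
   K(F,F,D_k) = m^2 (2 y.D_k - c_1.D_k), and supersymmetry gives
     m^2 (y.y - y.c_1 + c_1.c_1/3) = j.j + 2 j_0 u.y,
     u.y < u.c_1/2 - j_0 c_1.c_1/12.
   The second relation makes sum_k u_k K(F,F,D_k) negative for each stack, and
   by the tadpoles the sum over all stacks is at least -12 u.c_1; so every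
   stack satisfies m^2 (u.c_1 - 2 u.y) <= 12 u.c_1.

   Positivity of M_{i,k} means v.v <= 2 x_{i,k} (v.D_i)(v.D_k). Hence all
   products v.D_k of a time-like v have the same sign, and (u.v)^2 is much
   larger than v.v times any fixed multiple of sum_k u_k when J is large. It
   follows that m^2 < 24, and that y cannot have all y.D_k >= 0 and some
   y.D_i > 0. So a stack with y.D_i > 0 has some y.D_k < 0, bounded away from 0
   by integrality, which bounds y.y above by - (2/5) x_{i,k} y.D_i, while a
   stack with y'.y' > 0 has all y'.D_k < 0.

   Stacks of the second kind may occur with arbitrarily large y'.y', but the
   common Kaehler class forces y.D_k <= y'.D_k for some k, hence
   (y'.y') (y.D_i) <= (y.y) (y'.D_i). Therefore one constant
   rho >= (2/5) min x satisfies K(F,F,D_0) <= - rho m^2 y.D_i for all stacks of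
   the configuration, and summing over them gives the bound. *)
Require Import Defs.
From mathcomp Require Import all_boot all_order all_algebra.
From mathcomp Require Import reals.
From mathcomp Require Import ring lra.

Set Implicit Arguments.
Unset Strict Implicit.
Unset Printing Implicit Defensive.

Import Order.TTheory GRing.Theory Num.Theory.
Local Open Scope ring_scope.

(** * Bilinear forms in coordinates *)

Section BilinearForm.
Variables (S : comPzRingType) (n : nat) (A : 'M[S]_n).
Implicit Types u v w : 'rV[S]_n.

Lemma bformE u v : bform A u v = \sum_i \sum_j u 0 i * A i j * v 0 j.
Proof.
rewrite /bform mxE exchange_big; apply: eq_bigr => j _.
by rewrite !mxE mulr_suml; apply: eq_bigr => i _.
Qed.

Lemma bformDl u v w : bform A (u + v) w = bform A u w + bform A v w.
Proof. by rewrite /bform !mulmxDl mxE. Qed.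

Lemma bformZl a u v : bform A (a *: u) v = a * bform A u v.
Proof. by rewrite /bform -!scalemxAl mxE. Qed.

Lemma bform_delta_l i v : bform A (delta_mx 0 i) v = \sum_j A i j * v 0 j.
Proof.
rewrite /bform -rowE mxE; apply: eq_bigr => j _.
by rewrite !mxE.
Qed.

Lemma bform_suml u v :
  bform A u v = \sum_i u 0 i * bform A (delta_mx 0 i) v.
Proof.
rewrite bformE; apply: eq_bigr => i _.
by rewrite bform_delta_l mulr_sumr; apply: eq_bigr => j _; rewrite mulrA.
Qed.

Hypothesis symA : A^T = A.

Lemma bformC u v : bform A u v = bform A v u.
Proof.
rewrite !bformE exchange_big; apply: eq_bigr => j _; apply: eq_bigr => i _.
by rewrite -[in LHS]symA mxE mulrC [u 0 i * _]mulrC mulrA.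
Qed.

Lemma bformDr u v w : bform A u (v + w) = bform A u v + bform A u w.
Proof. by rewrite bformC bformDl !(bformC u). Qed.

Lemma bformZr a u v : bform A u (a *: v) = a * bform A u v.
Proof. by rewrite bformC bformZl (bformC u). Qed.

Lemma bform_delta_r i v : bform A v (delta_mx 0 i) = \sum_j A i j * v 0 j.
Proof. by rewrite bformC bform_delta_l. Qed.

Lemma bform_sumr u v :
  bform A u v = \sum_i u 0 i * bform A v (delta_mx 0 i).
Proof. by rewrite bform_suml; apply: eq_bigr => i _; rewrite bformC. Qed.

End BilinearForm.

Lemma ord_other (p : nat) (i : 'I_p) : (2 <= p)%N -> exists k : 'I_p, i != k.
Proof.
move=> p2; have [->|] := eqVneq i (Ordinal p2); last by exists (Ordinal p2).
by exists (Ordinal (ltnW p2)).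
Qed.

(** * The triple intersection form and the matrices M_{i,k}, reduced to the form on B *)

Lemma K00E (R : realType) (p : nat) (B : base_data p) (i : 'I_p) :
  ratr (K00 B i) = \sum_j Cr R B i j * map_mx ratr (bvec B) 0 j :> R.
Proof.
rewrite /K00 rmorph_sum; apply: eq_bigr => j _.
by rewrite rmorphM /= ratr_int !mxE mulrC.
Qed.

Definition pullback_part (S : Type) (p : nat) (F : 'rV[S]_p.+1) : 'rV[S]_p :=
  \row_i F 0 (lift ord0 i).

Section TripleIntersection.
Variables (R : realType) (p : nat) (B : base_data p).
Let A := Cr R B.
Let b : 'rV[R]_p := map_mx ratr (bvec B).

Lemma K000E : ratr (K000 B) = bform A b b.
Proof.
rewrite bformE /K000 rmorph_sum; apply: eq_bigr => i _.
rewrite rmorph_sum; apply: eq_bigr => j _.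
by rewrite !rmorphM /= ratr_int !mxE mulrAC.
Qed.

Lemma KrE (x y z : 'rV[R]_p.+1) : A^T = A ->
  let x0 := x 0 ord0 in let y0 := y 0 ord0 in let z0 := z 0 ord0 in
  let x' := pullback_part x in let y' := pullback_part y in
  let z' := pullback_part z in
  Kr B x y z = x0 * y0 * z0 * bform A b b
    + (x0 * y0 * bform A b z' + x0 * z0 * bform A b y' + y0 * z0 * bform A b x')
    + (x0 * bform A y' z' + y0 * bform A x' z' + z0 * bform A x' y').
Proof.
move=> symA x0 y0 z0 x' y' z'.
have K1 i : ratr (K00 B i) = bform A b (delta_mx 0 i).
  by rewrite bform_delta_r // K00E.
have K2 i j : ratr (Cq B i j) = A i j by rewrite /Cq ratr_int mxE.
pose k I J L : R := ratr (intersection_number B I J L).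
(* [row I] is the intersection number of D_I with y and z. The term with three pulled-back classes
   vanishes, so only rows with at least one index [ord0] leave a trace of the form on B. *)
pose row I := \sum_J \sum_L y 0 J * z 0 L * k I J L.
have row0 : row ord0 = y0 * z0 * bform A b b
    + (y0 * bform A b z' + z0 * bform A b y') + bform A y' z'.
  rewrite /row big_ord_recl big_ord_recl /k /intersection_number !unlift_none K000E.
  have -> : bform A b z' = \sum_i z' 0 i * bform A b (delta_mx 0 i).
    by rewrite bformC // bform_sumr.
  have -> : bform A b y' = \sum_i y' 0 i * bform A b (delta_mx 0 i).
    by rewrite bformC // bform_sumr.
  rewrite -!addrA; congr (_ + _); rewrite !mulr_sumr; congr (_ + _).
    by apply: eq_bigr => i _; rewrite liftK K1 mxE mulrA.
  rewrite bformE -big_split; apply: eq_bigr => i _ /=.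
  rewrite big_ord_recl liftK unlift_none K1 mxE; congr (_ + _).
    by rewrite mulrA [z0 * _]mulrC.
  by apply: eq_bigr => j _; rewrite liftK K2 !mxE mulrAC.
have rowS i : row (lift ord0 i) = y0 * z0 * bform A b (delta_mx 0 i)
    + (y0 * bform A (delta_mx 0 i) z' + z0 * bform A (delta_mx 0 i) y').
  rewrite /row big_ord_recl big_ord_recl /k /intersection_number !unlift_none.
  rewrite liftK K1 -!addrA !bform_delta_l; congr (_ + _).
  rewrite !mulr_sumr; congr (_ + _); apply: eq_bigr => j _.
    by rewrite liftK K2 !mxE mulrAC mulrA.
  rewrite big_ord_recl liftK unlift_none K2 big1 => [|l _]; last first.
    by rewrite liftK rmorph0 mulr0.
  by rewrite addr0 [y' 0 j]mxE /z0; ring.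
have -> : Kr B x y z = x0 * row ord0 + \sum_i x' 0 i * row (lift ord0 i).
  rewrite /Kr /trilinear big_ord_recl; congr (_ + _).
    rewrite mulr_sumr; apply: eq_bigr => J _; rewrite mulr_sumr.
    by apply: eq_bigr => L _; rewrite !mulrA.
  apply: eq_bigr => i _; rewrite mxE mulr_sumr; apply: eq_bigr => J _.
  by rewrite mulr_sumr; apply: eq_bigr => L _; rewrite !mulrA.
have -> : \sum_i x' 0 i * row (lift ord0 i) = y0 * z0 * bform A b x'
    + (y0 * bform A x' z' + z0 * bform A x' y').
  rewrite (bformC symA b x') [bform A x' b]bform_suml (bform_suml A x' z').
  rewrite (bform_suml A x' y') !mulr_sumr -!big_split; apply: eq_bigr => i _ /=.
  by rewrite rowS (bformC symA b); ring.
by rewrite row0; ring.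
Qed.

End TripleIntersection.

(** The two x-terms of M symmetrise the product of the linear forms v.D_i and v.D_k, so each
    contributes that product once on the diagonal. *)
Lemma bform_Mpair (R : realType) (p : nat) (B : base_data p)
    (x : {set 'I_p} -> rat) (i k : 'I_p) (v : 'rV[R]_p) :
  (Cr R B)^T = Cr R B ->
  bform (map_mx ratr (Mpair B x i k)) v v
  = 2 * ratr (x [set i; k]) * bform (Cr R B) v (delta_mx 0 i)
      * bform (Cr R B) v (delta_mx 0 k) - bform (Cr R B) v v.
Proof.
move=> symA; set A := Cr R B.
have AE a c : (Cmat B a c)%:~R = A a c by rewrite mxE.
have Asym a c : A a c = A c a by rewrite -[A in LHS]symA [LHS]mxE.
pose r : R := ratr (x [set i; k]).
have prod a c : bform A v (delta_mx 0 a) * bform A v (delta_mx 0 c)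
    = \sum_j \sum_l A a j * v 0 j * (A c l * v 0 l).
  by rewrite !bform_delta_r // big_distrlr.
transitivity (r * (bform A v (delta_mx 0 i) * bform A v (delta_mx 0 k))
  + r * (bform A v (delta_mx 0 k) * bform A v (delta_mx 0 i)) - bform A v v).
  rewrite !prod !bformE !mulr_sumr -sumrN -!big_split; apply: eq_bigr => j _ /=.
  rewrite !mulr_sumr -sumrN -!big_split; apply: eq_bigr => l _ /=.
  rewrite !mxE /Cq rmorphB rmorphD !rmorphM /= !ratr_int !AE -/r (Asym k j).
  by ring.
by rewrite /r; ring.
Qed.

(** * Scalar inequalities behind the three exclusion arguments *)

(* Here [M], [Y], [z], [yb] stand for [m^2], [y.y], [u.y], [y.c_1], and [S] for
   the sum of the coordinates of [u]; [J] bounds the coordinates of the Kaehler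
   class from below. *)
Section Estimates.
Variables (R : realFieldType) (K X J j0 S jj bb ub : R).
Hypotheses (K1 : 1 <= K) (X1 : 1 <= X) (JKX : 60 * 60 * (K * X) <= J).
Hypotheses (Jj0 : J <= j0) (JS : J <= S) (Jbb : 72 * bb <= J).
Hypotheses (jj0 : 0 <= jj) (bb0 : 0 <= bb) (ub0 : 0 < ub) (ubKS : ub <= K * S).

Lemma JK_ge : 60 * 60 * K <= J.
Proof.
have KX : K * 1 <= K * X by apply: ler_wpM2l X1; apply: le_trans ler01 K1.
by move: JKX; lra.
Qed.

(** The closing step of the first two contradictions: the reversed Cauchy-Schwarz inequality has two
    factors of size J against the fixed K X, with ample room for the constant c. *)
Lemma j0JS_gt c : c <= 60 * 60 -> c * X * (K * S) < j0 * J * S.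
Proof.
move: K1 X1 JKX Jj0 JS => hK hX hKX hj0 hS.
move=> c_le; have JK := JK_ge.
have J4 : 60 * 60 <= J by lra.
have S0 : 0 < S by lra.
have -> : c * X * (K * S) = c * (K * X) * S by ring.
rewrite ltr_pM2r //.
have KX0 : 0 <= K * X by apply: mulr_ge0; lra.
have h1 : c * (K * X) <= 60 * 60 * (K * X) by apply: ler_wpM2r.
have h2 : 60 * 60 * J <= j0 * J by apply: ler_wpM2r; lra.
lra.
Qed.

(** Here Y and z belong to the shifted class y - c_1/2, for which the equation has no linear term
    y.c_1. For M >= 24 the tadpole costs at most half of j_0 ub and the bb-term at most a quarter,
    so M Y >= j_0 ub / 4. With |M z| <= 6 ub this contradicts the reversed Cauchy-Schwarz
    inequality. *)
Lemma large_rank_absurd (M Y z : R) : 24 <= M ->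
  M * Y = jj + j0 * ub + 2 * j0 * z - M * bb / 12 ->
  - 6 * ub <= M * z -> z < - (j0 * bb / 12) ->
  (0 < Y -> Y * (S * J) <= X * z ^+ 2) -> False.
Proof.
move: K1 X1 JKX Jj0 JS Jbb jj0 bb0 ub0 ubKS => hK hX hKX hj0 hS hbb hjj hb hub hubK.
move=> M24 YE z_ge z_lt rcs; have JK := JK_ge.
have J4 : 60 * 60 <= J by lra.
have M0 : 0 < M by lra.
have j0bb : 0 <= j0 * bb by apply: mulr_ge0; lra.
have j0ub : 0 < j0 * ub by apply: mulr_gt0; lra.
have SJ0 : 0 < S * J by apply: mulr_gt0; lra.
have Mbb : M * bb / 12 <= j0 * ub / 4.
  have h : M * z <= M * (- (j0 * bb / 12)) by apply: ler_wpM2l; lra.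
  have Mbb0 : 0 <= M * bb by apply: mulr_ge0; lra.
  have h1 : 1 * (M * bb) <= j0 * (M * bb) by apply: ler_wpM2r; lra.
  have h2 : 24 * ub <= j0 * ub by apply: ler_wpM2r; lra.
  lra.
have zj : - (j0 * ub / 2) <= 2 * j0 * z.
  have h1 : j0 * (- 6 * ub) <= j0 * (M * z) by apply: ler_wpM2l; lra.
  have h2 : 24 * (j0 * ub) <= M * (j0 * ub) by apply: ler_wpM2r; lra.
  have : M * (- (j0 * ub / 2)) <= M * (2 * j0 * z) by lra.
  by rewrite ler_pM2l.
have MY_ge : j0 * ub / 4 <= M * Y by lra.
have Y0 : 0 < Y by rewrite -(pmulr_rgt0 _ M0); lra.
have {}rcs := rcs Y0.
have h1 : M * (M * Y) * (S * J) <= X * (M * z) ^+ 2.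
  have -> : M * (M * Y) * (S * J) = M ^+ 2 * (Y * (S * J)) by ring.
  have -> : X * (M * z) ^+ 2 = M ^+ 2 * (X * z ^+ 2) by ring.
  by apply: ler_wpM2l => //; apply: sqr_ge0.
have h2 : (M * z) ^+ 2 <= (6 * ub) ^+ 2.
  have Mz0 : 0 <= M * - z by apply: mulr_ge0; lra.
  by rewrite -[leLHS]sqrrN ler_sqr ?nnegrE; lra.
have h3 : 24 * (j0 * ub / 4) * (S * J) <= M * (M * Y) * (S * J).
  by apply: ler_wpM2r; [lra | apply: ler_pM; lra].
have h4 : X * (M * z) ^+ 2 <= X * (6 * ub) ^+ 2 by apply: ler_wpM2l; lra.
have h5 : 36 * X * ub * ub <= 36 * X * ub * (K * S).
  by apply: ler_wpM2l => //; apply: mulr_ge0; lra.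
have h6 : 6 * ub * (6 * X * (K * S)) < 6 * ub * (j0 * J * S).
  by rewrite ltr_pM2l ?j0JS_gt; lra.
lra.
Qed.

(** A positive z of size J makes M Y >= j_0 z, so reversed Cauchy-Schwarz forces z to be much larger
    than K S, while supersymmetry keeps z below ub/2. *)
Lemma future_absurd (M Y z yb : R) : 1 <= M -> M < 24 ->
  M * (Y - yb + bb / 3) = jj + 2 * j0 * z -> z < ub / 2 - j0 * bb / 12 ->
  J * (1 / 5) <= z -> 0 <= yb ->
  (0 < Y -> Y * (S * J) <= X * z ^+ 2) -> False.
Proof.
move: K1 X1 JKX Jj0 JS Jbb jj0 bb0 ub0 ubKS => hK hX hKX hj0 hS hbb hjj hb hub hubK.
move=> M1 M24 YE z_lt z_ge yb0 rcs; have JK := JK_ge.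
have J4 : 60 * 60 <= J by lra.
have M0 : 0 < M by lra.
have z0 : 0 < z by lra.
have j0bb : 0 <= j0 * bb by apply: mulr_ge0; lra.
have SJ0 : 0 < S * J by apply: mulr_gt0; lra.
have j0z : 60 * 60 * z <= j0 * z by apply: ler_wpM2r; lra.
have Mbb : M * bb <= 24 * bb by apply: ler_wpM2r; lra.
have Myb : 0 <= M * yb by apply: mulr_ge0; lra.
have MY : j0 * z <= M * Y by lra.
have Y0 : 0 < Y by rewrite -(pmulr_rgt0 _ M0); lra.
have Y_ge : j0 * z <= 24 * Y.
  by apply: le_trans MY _; apply: ler_wpM2r; lra.
have {}rcs := rcs Y0.
have h1 : j0 * z * (S * J) <= 24 * Y * (S * J) by apply: ler_wpM2r; lra.
have h2 : X * z * z <= X * z * (K * S).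
  by apply: ler_wpM2l; [apply: mulr_ge0; lra | lra].
have h3 : z * (24 * X * (K * S)) < z * (j0 * J * S).
  by rewrite ltr_pM2l ?j0JS_gt; lra.
lra.
Qed.

(** Since Y' > 0 and yb' <= 0, the primed equation gives jj + 2 j_0 z' >= 0. The gap z - z' then
    makes the right side of the unprimed equation at least j_0 S / 12, while its left side is at
    most of order K S: Y is negative, and yb >= yb' >= z' >= -6 ub. *)
Lemma compare_absurd (M Y z yb M' Y' z' yb' : R) : 1 <= M -> M < 24 -> 1 <= M' ->
  M * (Y - yb + bb / 3) = jj + 2 * j0 * z ->
  M' * (Y' - yb' + bb / 3) = jj + 2 * j0 * z' ->
  z' < ub / 2 - j0 * bb / 12 -> M' * (ub - 2 * z') <= 12 * ub ->
  Y < 0 -> 0 < Y' -> S / 24 <= z - z' -> yb' <= yb -> z' <= yb' -> yb' <= 0 ->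
  False.
Proof.
move: K1 X1 JKX Jj0 JS Jbb jj0 bb0 ub0 ubKS => hK hX hKX hj0 hS hbb hjj hb hub hubK.
move=> M1 M24 M'1 YE YE' z'_lt T' Y0 Y'0 zz' yy' zy' yb'0; have JK := JK_ge.
have J4 : 60 * 60 <= J by lra.
have M0 : 0 < M by lra.
have j0bb : 0 <= j0 * bb by apply: mulr_ge0; lra.
have z'_ge : - (6 * ub) <= z'.
  have : 1 * (ub - 2 * z') <= M' * (ub - 2 * z') by apply: ler_wpM2r; lra.
  lra.
have E' : 0 <= jj + 2 * j0 * z' by rewrite -YE'; apply: mulr_ge0; lra.
have Mbb : M * bb <= 24 * bb by apply: ler_wpM2r; lra.
have MY : M * Y <= 0 by apply: mulr_ge0_le0; lra.
have Myb : - (12 * 12 * (K * S)) <= M * yb.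
  have [yb0|yb0] := leP 0 yb; first by have := mulr_ge0 (ltW M0) yb0; lra.
  have : 24 * yb <= M * yb by apply: ler_wnM2r; lra.
  lra.
have h1 : j0 * (S / 24) <= j0 * (z - z') by apply: ler_wpM2l; lra.
have h2 : 60 * 60 * K * S <= j0 * S by apply: ler_wpM2r; lra.
have h3 : 1 * S <= K * S by apply: ler_wpM2r; lra.
lra.
Qed.

End Estimates.

(** * Classes y of the stacks with m nonzero *)

Section Branes.
Variables (R : realType) (p : nat) (A : 'M[R]_p) (b : 'rV[R]_p).
Variables (xi : 'I_p -> 'I_p -> R) (X K : R).
Hypotheses (p2 : (2 <= p)%N) (symA : A^T = A).
Local Notation dot := (bform A).
Local Notation e i := (delta_mx 0 i : 'rV[R]_p).

Hypothesis xi_gt0 : forall i k, i != k -> 0 < xi i k.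
Hypothesis dot_le : forall i k v, i != k ->
  dot v v <= 2 * xi i k * dot v (e i) * dot v (e k).

(** For distinct indices this is read off from [dot_le]. For equal ones it says that v.D_i is
    nonzero, which follows by pairing i with another index; this uses p >= 2. *)
Lemma timelike_same_sign (v : 'rV[R]_p) :
  0 < dot v v -> forall i k, 0 < dot v (e i) * dot v (e k).
Proof.
move=> v_gt0; have ne i k : i != k -> 0 < dot v (e i) * dot v (e k).
  move=> ik; have := lt_le_trans v_gt0 (dot_le v ik).
  by rewrite -mulrA pmulr_rgt0 // mulr_gt0 ?xi_gt0.
move=> i k; have [<-|] := eqVneq i k; last exact: ne.
have [l /ne] := ord_other i p2.
by rewrite -expr2 exprn_even_gt0 //=; apply: contraTneq => ->; rewrite mul0r ltxx.
Qed.

Lemma delta_dot_ge0 (t : 'rV[R]_p) : 0 < dot t t ->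
  (forall i, in_closed_light_cone A t (e i)) ->
  forall i k, 0 <= dot (e i) (e k).
Proof.
move=> t_gt0 cone.
have te_gt0 k : 0 < dot t (e k).
  rewrite lt_def (cone k).2 andbT.
  by apply: contraTneq (timelike_same_sign t_gt0 k k) => ->; rewrite mul0r ltxx.
move=> i k; rewrite leNgt; apply/negP => ik_lt0.
(* On the segment from e i towards t the form stays positive, but the product
   with e k would vanish at this point of it. *)
pose c := - dot (e i) (e k) / dot t (e k).
have c_gt0 : 0 < c by rewrite divr_gt0 ?oppr_gt0.
pose v := e i + c *: t.
have v_gt0 : 0 < dot v v.
  rewrite bformDl !(bformDr symA) !bformZl !(bformZr symA) (bformC symA _ t).
  have := mulr_gt0 c_gt0 (te_gt0 i).
  have := mulr_gt0 c_gt0 (mulr_gt0 c_gt0 t_gt0).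
  have := (cone i).1; lra.
have := timelike_same_sign v_gt0 k k.
rewrite bformDl bformZl /c mulfVK ?gt_eqF //.
by rewrite subrr mul0r ltxx.
Qed.

Variables (J j0 : R) (j : 'rV[R]_p).
(** For a class f pulled back from B, K(J,J,f) = 2 j_0 u.f, where J is the Kaehler class. In this
    section the variable [J] is a number, the lower bound for the Kaehler coordinates. *)
Let u : 'rV[R]_p := j + (j0 / 2) *: b.
Let S : R := \sum_k u 0 k.

Hypotheses (X_ge1 : 1 <= X) (K_ge1 : 1 <= K).
Hypothesis xi_le : forall i k, i != k -> 2 * xi i k <= X.
Hypothesis b_ge0 : forall k, 0 <= b 0 k.
Hypothesis bK_gt0 : forall k, 0 < dot b (e k).
Hypothesis bK_le : forall k, dot b (e k) <= K.
Hypothesis A_ge0 : forall i k, 0 <= dot (e i) (e k).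
Hypotheses (J_ge : 60 * 60 * (K * X) <= J) (J_geb2 : 72 * dot b b <= J).
Hypotheses (J_geb : forall k, b 0 k <= J).
Hypotheses (j0_ge : J <= j0) (j_ge : forall k, J <= j 0 k).

Lemma dot_coordE v : dot u v = \sum_k u 0 k * dot v (e k).
Proof. exact: bform_sumr. Qed.

Lemma X_ge0 : 0 <= X. Proof. exact: le_trans ler01 X_ge1. Qed.

Lemma KX_ge1 : 1 <= K * X.
Proof. by rewrite -[1]mulr1 ler_pM. Qed.

Lemma J_large : 60 * 60 <= J.
Proof. by have := KX_ge1; have := J_ge; lra. Qed.

Lemma coord_ge k : J <= u 0 k.
Proof.
rewrite !mxE; have : 0 <= j0 / 2 * b 0 k.
  by rewrite mulr_ge0 //; have := J_large; have := j0_ge; lra.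
by have := j_ge k; lra.
Qed.

Lemma coord_gt0 k : 0 < u 0 k.
Proof. by have := coord_ge k; have := J_large; lra. Qed.

Lemma sum_coord_ge : J <= S.
Proof.
rewrite /S (bigD1 (Ordinal p2)) //= -[J]addr0 lerD ?coord_ge // sumr_ge0 // => k _.
exact: ltW (coord_gt0 k).
Qed.

Lemma c1_sqr_ge0 : 0 <= dot b b.
Proof.
rewrite bform_sumr // sumr_ge0 // => k _.
by rewrite mulr_ge0 // ltW.
Qed.

Lemma dot_c1_gt0 : 0 < dot u b.
Proof.
rewrite dot_coordE (bigD1 (Ordinal p2)) //= ltr_pwDl ?mulr_gt0 ?coord_gt0 //.
rewrite sumr_ge0 // => k _.
by rewrite mulr_ge0 // ltW ?coord_gt0.
Qed.

Lemma dot_c1_le : dot u b <= K * S.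
Proof.
rewrite dot_coordE /S mulr_sumr; apply: ler_sum => k _.
by rewrite mulrC ler_wpM2r // ltW ?coord_gt0.
Qed.

Lemma kahler_sqr_ge0 : 0 <= dot j j.
Proof.
have j_ge0 k : 0 <= j 0 k by have := j_ge k; have := J_large; lra.
rewrite bform_sumr // sumr_ge0 // => k _; rewrite mulr_ge0 //.
by rewrite bform_suml sumr_ge0 // => l _; rewrite mulr_ge0.
Qed.

(* A reversed Cauchy-Schwarz inequality: expand [(u.v)^2], whose terms are all
   positive, and keep one off-diagonal term in each row. *)
Lemma timelike_dot_sqr_ge (v : 'rV[R]_p) :
  0 < dot v v -> dot v v * (S * J) <= X * dot u v ^+ 2.
Proof.
move=> v_gt0; have sgn := timelike_same_sign v_gt0.
have J_ge0 : 0 <= J by have := J_large; lra.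
have row i : dot v v * J <= X * (\sum_k u 0 k * (dot v (e i) * dot v (e k))).
  have [k ik] := ord_other i p2.
  apply: (@le_trans _ _ (X * (u 0 k * (dot v (e i) * dot v (e k))))); last first.
    rewrite ler_wpM2l ?X_ge0 // (bigD1 k) //= lerDl sumr_ge0 // => l _.
    by rewrite mulr_ge0 ?ltW ?coord_gt0.
  rewrite mulrCA mulrC; apply: ler_pM; rewrite ?coord_ge ?(ltW v_gt0) //.
  apply: le_trans (dot_le v ik) _.
  by rewrite -mulrA ler_wpM2r ?xi_le // ltW.
have -> : dot v v * (S * J) = \sum_i u 0 i * (dot v v * J).
  by rewrite -mulr_suml -/S; ring.
have -> : X * dot u v ^+ 2
    = \sum_i u 0 i * (X * (\sum_k u 0 k * (dot v (e i) * dot v (e k)))).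
  rewrite expr2 {1}dot_coordE mulr_suml mulr_sumr; apply: eq_bigr => i _.
  rewrite dot_coordE; under [in RHS]eq_bigr => k _ do rewrite mulrCA.
  by rewrite -mulr_sumr; ring.
by apply: ler_sum => i _; rewrite ler_wpM2l // ltW ?coord_gt0.
Qed.

Record brane (m : R) (y : 'rV[R]_p) : Prop := Brane {
  brane_m_int : m \is a Num.int;
  brane_m_neq0 : m != 0;
  brane_y_int : forall k, m * dot y (e k) \is a Num.int;
  brane_eq : m ^+ 2 * (dot y y - dot y b + dot b b / 3)
    = dot j j + 2 * j0 * dot u y;
  brane_lt : dot u y < dot u b / 2 - j0 * dot b b / 12;
  brane_tadpole : m ^+ 2 * (dot u b - 2 * dot u y) <= 12 * dot u b
}.

Lemma brane_m2_ge1 m y : brane m y -> 1 <= m ^+ 2.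
Proof. by case=> m_int m0 _ _ _ _; apply: sqr_intr_ge1. Qed.

Lemma brane_m2_lt m y : brane m y -> m ^+ 2 < 24.
Proof.
move=> br; rewrite ltNge; apply/negP => M_ge.
have [_ _ _ eqE ltI leT] := br.
move: (m ^+ 2) eqE leT M_ge => M eqE leT M_ge.
(* Shifting by c_1/2 completes the square in y.y - y.c_1. *)
pose y' := y - 2^-1 *: b.
have uy' : dot u y' = dot u y - dot u b / 2.
  by rewrite (bformDr symA) -scaleNr (bformZr symA); ring.
have yy' : dot y' y' = dot y y - dot y b + dot b b / 4.
  rewrite /y' -scaleNr bformDl !(bformDr symA) !bformZl !(bformZr symA).
  by rewrite (bformC symA b y); field.
apply: (large_rank_absurd K_ge1 X_ge1 J_ge j0_ge sum_coord_ge J_geb2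
  kahler_sqr_ge0 c1_sqr_ge0 dot_c1_gt0 dot_c1_le M_ge _ _ _
  (@timelike_dot_sqr_ge y')).
- rewrite uy' yy'; move: eqE; move: (dot y b) (dot y y) (dot u y) => yb yy uy.
  by move: (dot u b) (dot j j) (dot b b) => ub jj bb; lra.
- by rewrite uy'; move: leT; move: (dot u y) (dot u b) => uy ub; lra.
- by rewrite uy'; move: ltI; move: (dot u y) (dot u b) (dot b b) => uy ub bb; lra.
Qed.

(** The integer m (y.D_k) is nonzero, and m^2 < 24 < 25. *)
Lemma brane_coord_ge m y k :
  brane m y -> dot y (e k) != 0 -> 1 / 5 <= `|dot y (e k)|.
Proof.
move=> br y0; have [m_int m0 y_int _ _ _] := br.
have ge1 : 1 <= m ^+ 2 * dot y (e k) ^+ 2.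
  by rewrite -exprMn; apply: sqr_intr_ge1; rewrite ?mulf_neq0.
rewrite leNgt; apply/negP => y_lt.
have : `|dot y (e k)| ^+ 2 <= (1 / 5) ^+ 2.
  by rewrite ler_sqr ?nnegrE ?normr_ge0 ?(ltW y_lt) //; lra.
rewrite -normrX ger0_norm ?sqr_ge0 // => y2_le.
have := ler_pM (sqr_ge0 m) (sqr_ge0 _) (ltW (brane_m2_lt br)) y2_le.
lra.
Qed.

(** The product m m' clears both denominators, and its square is below 24^2. *)
Lemma brane_coord_diff m y m' y' k : brane m y -> brane m' y' ->
  dot y' (e k) < dot y (e k) -> 1 / 24 <= dot y (e k) - dot y' (e k).
Proof.
move=> br br'; have [m_int m0 y_int _ _ _] := br.
have [m'_int m'0 y'_int _ _ _] := br'.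
rewrite -subr_gt0; set d := _ - _ => d_gt0.
have d_int : m * m' * d \is a Num.int.
  have -> : m * m' * d = m' * (m * dot y (e k)) - m * (m' * dot y' (e k)).
    by rewrite /d; ring.
  by apply: rpredB; apply: rpredM; rewrite ?y_int ?y'_int.
have ge1 : 1 <= m ^+ 2 * m' ^+ 2 * d ^+ 2.
  by rewrite -!exprMn; apply: sqr_intr_ge1 => //; rewrite !mulf_neq0 // gt_eqF.
rewrite leNgt; apply/negP => d_lt.
have d2 : d ^+ 2 <= (1 / 24) ^+ 2.
  by rewrite ler_sqr ?nnegrE ?(ltW d_gt0) ?(ltW d_lt) //; lra.
have mm : m ^+ 2 * m' ^+ 2 < 24 * 24.
  by rewrite ltr_pM ?sqr_ge0 ?(brane_m2_lt br) ?(brane_m2_lt br').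
have : m ^+ 2 * m' ^+ 2 * d ^+ 2 < 24 * 24 * d ^+ 2.
  by rewrite ltr_pM2r ?exprn_gt0.
lra.
Qed.

Lemma brane_mixed m y i : brane m y -> 0 < dot y (e i) ->
  exists2 k, i != k & dot y (e k) <= - (1 / 5).
Proof.
move=> br yi_gt0; have [m_int m0 y_int eqE ltI leT] := br.
have M_lt := brane_m2_lt br; have M_ge1 := brane_m2_ge1 br.
have [/existsP [k yk_lt0]|] := boolP [exists k, dot y (e k) < 0].
  exists k; first by apply: contraTneq yk_lt0 => <-; rewrite -leNgt ltW.
  have := brane_coord_ge br (negbT (lt_eqF yk_lt0)).
  by rewrite ltr0_norm //; lra.
rewrite negb_exists => /forallP y_ge0; exfalso.
have {}y_ge0 k : 0 <= dot y (e k) by rewrite leNgt.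
have yi_ge : 1 / 5 <= dot y (e i).
  by rewrite -[dot y _]gtr0_norm // (brane_coord_ge br) ?gt_eqF.
have J4 := J_large.
have uy_ge : J * (1 / 5) <= dot u y.
  rewrite dot_coordE (bigD1 i) //= -[leLHS]addr0 lerD ?sumr_ge0 // => [|k _].
    by rewrite ler_pM ?coord_ge //; lra.
  by rewrite mulr_ge0 ?y_ge0 // ltW ?coord_gt0.
have yb_ge0 : 0 <= dot y b.
  by rewrite (bformC symA) bform_sumr // sumr_ge0 // => k _; rewrite mulr_ge0.
exact: (future_absurd K_ge1 X_ge1 J_ge j0_ge sum_coord_ge J_geb2
  kahler_sqr_ge0 c1_sqr_ge0 dot_c1_gt0 dot_c1_le M_ge1 M_lt eqE ltI
  uy_ge yb_ge0 (@timelike_dot_sqr_ge y)).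
Qed.

Lemma brane_mixed_le m y i : brane m y -> 0 < dot y (e i) ->
  exists2 k, i != k & dot y y <= - (2 / 5) * xi i k * dot y (e i).
Proof.
move=> br yi; have [k ik yk] := brane_mixed br yi; exists k => //.
apply: le_trans (dot_le y ik) _.
have := mulr_gt0 (xi_gt0 ik) yi => xy.
have : xi i k * dot y (e i) * dot y (e k) <= xi i k * dot y (e i) * - (1 / 5).
  by rewrite ler_pM2l.
lra.
Qed.

(* Both stacks solve the supersymmetry equation for the same Kaehler class, so
   u.y is below - j.j / (2 j_0) for the first one and above it for the second,
   up to small terms. *)
Lemma brane_compare m y m' y' i : brane m y -> brane m' y' ->
  0 < dot y (e i) -> 0 < dot y' y' -> (forall k, dot y' (e k) < 0) ->
  exists2 k, i != k & dot y (e k) <= dot y' (e k).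
Proof.
move=> br br' yi_gt0 yy'_gt0 y'_lt0.
have [k0 ik0 yk0] := brane_mixed br yi_gt0.
have [m_int m0 y_int eqE ltI leT] := br.
have [m'_int m'0 y'_int eqE' ltI' leT'] := br'.
have M_lt := brane_m2_lt br; have M_ge1 := brane_m2_ge1 br.
have M'_ge1 := brane_m2_ge1 br'.
have [/existsP [k yk_le]|] := boolP [exists k, dot y (e k) <= dot y' (e k)].
  exists k => //; apply: contraTneq yk_le => <-; rewrite -ltNge.
  exact: lt_trans (y'_lt0 i) yi_gt0.
rewrite negb_exists => /forallP y'y; exfalso.
have {}y'y k : dot y' (e k) < dot y (e k) by rewrite ltNge.
have yy_lt0 : dot y y < 0.
  apply: le_lt_trans (dot_le y ik0) _.
  by rewrite pmulr_rlt0 ?mulr_gt0 ?xi_gt0 //; lra.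
have uyy' : S / 24 <= dot u y - dot u y'.
  rewrite !dot_coordE -sumrB /S mulr_suml; apply: ler_sum => k _.
  rewrite -mulrBr ler_wpM2l ?(ltW (coord_gt0 k)) //.
  by have := brane_coord_diff br br' (y'y k); lra.
have y'b_le : dot y' b <= dot y b.
  rewrite !(bformC symA _ b) !(bform_sumr symA b); apply: ler_sum => k _.
  by rewrite ler_wpM2l // ltW.
(* Since b_k <= J <= u_k and every y'.D_k is negative, replacing u by c_1 can only increase the sum.
   Together with the tadpole this bounds y'.c_1 from below. *)
have y'b_ge : dot u y' <= dot y' b.
  rewrite dot_coordE (bformC symA _ b) (bform_sumr symA b); apply: ler_sum => k _.
  by rewrite ler_wnM2r ?(ltW (y'_lt0 k)) // (le_trans (J_geb k)) ?coord_ge.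
have y'b_le0 : dot y' b <= 0.
  rewrite (bformC symA _ b) (bform_sumr symA b) sumr_le0 // => k _.
  by rewrite mulr_ge0_le0 // ltW.
exact: (compare_absurd K_ge1 X_ge1 J_ge j0_ge sum_coord_ge J_geb2
  kahler_sqr_ge0 c1_sqr_ge0 dot_c1_gt0 dot_c1_le M_ge1 M_lt M'_ge1
  eqE eqE' ltI' leT' yy_lt0 yy'_gt0 uyy' y'b_le y'b_ge).
Qed.

(** If y'.y' <= 0, signs suffice. Otherwise all y'.D_k are negative; with k from [brane_compare],
    both sides are compared through the common factor 2 x_{i,k} (y.D_i)(y'.D_i), multiplied by
    y'.D_k on the left and by y.D_k on the right. *)
Lemma brane_cross m y m' y' i : brane m y -> brane m' y' ->
  0 < dot y (e i) -> dot y' (e i) <= 0 ->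
  dot y' y' * dot y (e i) <= dot y y * dot y' (e i).
Proof.
move=> br br' yi_gt0 y'i_le0.
have [k0 ik0 yk0] := brane_mixed br yi_gt0.
have [yy'|yy'_gt0] := leP (dot y' y') 0.
  apply: (@le_trans _ _ 0); first by rewrite mulr_le0_ge0 // ltW.
  rewrite mulr_le0 //; apply: le_trans (dot_le y ik0) _.
  by rewrite mulr_ge0_le0 ?mulr_ge0 ?(ltW (xi_gt0 ik0)) ?(ltW yi_gt0) //; lra.
have sgn := timelike_same_sign yy'_gt0.
have y'_lt0 k : dot y' (e k) < 0.
  rewrite ltNge; apply/negP => y'k; have := sgn i k.
  by rewrite ltNge mulr_le0_ge0.
have [k ik yk] := brane_compare br br' yi_gt0 yy'_gt0 y'_lt0.
have yi0 := ltW yi_gt0.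
have h1 : dot y' y' * dot y (e i)
    <= 2 * xi i k * dot y' (e i) * dot y' (e k) * dot y (e i).
  by rewrite ler_wpM2r // dot_le.
have h2 : 2 * xi i k * dot y (e i) * dot y (e k) * dot y' (e i)
    <= dot y y * dot y' (e i).
  by rewrite ler_wnM2r // dot_le.
apply: le_trans h1 (le_trans _ h2).
have -> : 2 * xi i k * dot y' (e i) * dot y' (e k) * dot y (e i)
  = (2 * xi i k * dot y (e i)) * (dot y' (e i) * dot y' (e k)) by ring.
have -> : 2 * xi i k * dot y (e i) * dot y (e k) * dot y' (e i)
  = (2 * xi i k * dot y (e i)) * (dot y' (e i) * dot y (e k)) by ring.
rewrite ler_wpM2l ?ler_wnM2l // !mulr_ge0 //; exact: ltW (xi_gt0 ik).
Qed.

End Branes.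

(** * Weighted sums under a cross inequality *)

(* The cross inequality says that the ratios [- q s / a s] with [0 < a s]
   dominate the ratios [q s' / - a s'] with [a s' <= 0], so some [rho >= r]
   separates them and [q s <= - rho * a s] for all [s]. *)
Lemma weighted_sum_le (R : realFieldType) (I : finType) (r : R) (N a q : I -> R) :
  (forall s, 0 <= N s) ->
  (forall s, 0 < a s -> q s <= - r * a s) ->
  (forall s s', 0 < a s -> a s' <= 0 -> q s' * a s <= q s * a s') ->
  0 < \sum_s N s * a s -> \sum_s N s * q s <= - r * \sum_s N s * a s.
Proof.
move=> N_ge0 q_le cross.
pose ap := \sum_(s | 0 < a s) N s * a s.
pose an := \sum_(s | ~~ (0 < a s)) N s * a s.
pose qp := \sum_(s | 0 < a s) N s * q s.
pose qn := \sum_(s | ~~ (0 < a s)) N s * q s.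
have -> : \sum_s N s * a s = ap + an by rewrite (bigID (fun s => 0 < a s)).
have -> : \sum_s N s * q s = qp + qn by rewrite (bigID (fun s => 0 < a s)).
have an_le0 : an <= 0.
  by rewrite sumr_le0 // => s; rewrite -leNgt => a_le; rewrite mulr_ge0_le0.
have qp_le : qp <= - r * ap.
  rewrite /qp /ap mulr_sumr; apply: ler_sum => s a_gt0.
  by rewrite mulrCA ler_wpM2l ?q_le.
have cross_sum : qn * ap <= an * qp.
  rewrite /qn /an !big_distrlr /=; apply: ler_sum => s'; rewrite -leNgt => a'_le.
  apply: ler_sum => s a_gt0; have := cross s s' a_gt0 a'_le.
  move=> /(ler_wpM2l (mulr_ge0 (N_ge0 s') (N_ge0 s))); lra.
move=> tot_gt0; have ap_gt0 : 0 < ap by lra.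
(* After multiplication by [ap]: (qp + qn) ap <= (ap + an) qp <= (ap + an) (- r ap). *)
rewrite -(ler_pM2r ap_gt0).
have := ler_wpM2r (ltW tot_gt0) qp_le; lra.
Qed.

(** * Flux numbers and supersymmetry conditions in terms of m and y *)

Lemma map_ratr_divisor (R : realType) (p : nat) (I : 'I_p.+1) :
  map_mx ratr (divisor rat I) = divisor R I.
Proof. by apply/rowP => J; rewrite !mxE rmorph_nat. Qed.

Lemma ratr_Kq (R : realType) (p : nat) (B : base_data p) (F G H : 'rV[rat]_p.+1) :
  ratr (Kq B F G H) = Kr B (map_mx ratr F) (map_mx ratr G) (map_mx ratr H) :> R.
Proof.
rewrite /Kq /Kr /trilinear !rmorph_sum; apply: eq_bigr => I _.
rewrite rmorph_sum; apply: eq_bigr => J _; rewrite rmorph_sum; apply: eq_bigr => L _.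
by rewrite !rmorphM !mxE.
Qed.

Lemma ratr_int_num (R : realType) (q : rat) :
  q \is a Num.int -> (ratr q : R) \is a Num.int.
Proof. by case/intrP => z ->; rewrite ratr_int intr_int. Qed.

Section FluxIntersections.
Variables (R : realType) (p : nat) (B : base_data p).
Let A := Cr R B.
Hypothesis symA : A^T = A.
Let b : 'rV[R]_p := map_mx ratr (bvec B).
Local Notation dot := (bform A).
Local Notation e i := (delta_mx 0 i : 'rV[R]_p).
Variables (F J : 'rV[R]_p.+1).
Let m := F 0 ord0.
(** This is m y when m is nonzero, but it also makes sense for m = 0; it turns K(F,F,D_0) into the
    single square v.v. *)
Let v := pullback_part F + m *: b.

Lemma pullback_divisor0 : pullback_part (divisor R (@ord0 p)) = 0.
Proof. by apply/rowP => k; rewrite !mxE. Qed.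

Lemma pullback_divisorS i : pullback_part (divisor R (lift ord0 i)) = e i.
Proof. by apply/rowP => k; rewrite !mxE (inj_eq lift_inj). Qed.

Lemma bform0r u : dot u 0 = 0.
Proof. by rewrite -(scale0r 0) (bformZr symA) mul0r. Qed.

Lemma Kr_divisor0 : Kr B F F (divisor R ord0) = dot v v.
Proof.
rewrite KrE // pullback_divisor0 !bform0r !mxE !eqxx /= -/m -/A -/b /v.
rewrite bformDl !(bformDr symA) !bformZl !(bformZr symA) (bformC symA _ b).
by ring.
Qed.

Lemma Kr_divisorS i : Kr B F F (divisor R (lift ord0 i))
  = 2 * (m * dot v (e i)) - m ^+ 2 * dot b (e i).
Proof.
rewrite KrE // pullback_divisorS [divisor _ _ _ _]mxE eqxx /= -/m -/A -/b /v.
by rewrite bformDl bformZl; ring.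
Qed.

Let j0 := J 0 ord0.
Let j := pullback_part J.
Let u := j + (j0 / 2) *: b.

(** For m = 0 the flux is pulled back from B, so K(F,F,F) = 0 and K(J,J,F) = 2 j_0 u.v. *)
Lemma susy_orthogonal : m = 0 -> j0 != 0 -> 3 * Kr B J J F = Kr B F F F ->
  dot u v = 0.
Proof.
rewrite !KrE // -/A -/b -/m -/j0 -/j /u /v => -> j0_neq0.
rewrite scale0r addr0 bformDl bformZl => eqE.
apply: (mulfI j0_neq0); lra.
Qed.

Hypothesis m_neq0 : m != 0.
Let y := m^-1 *: v.

Lemma susy_brane_eq : 3 * Kr B J J F = Kr B F F F ->
  m ^+ 2 * (dot y y - dot y b + dot b b / 3) = dot j j + 2 * j0 * dot u y.
Proof.
have fE : pullback_part F = m *: y - m *: b.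
  by rewrite /y scalerA mulfV // scale1r /v addrK.
move: y fE => z fE; rewrite !KrE // fE -!scaleNr -/A -/b -/m -/j0 -/j /u.
rewrite !bformDl !(bformDr symA) !bformZl !(bformZr symA).
rewrite (bformC symA z b) (bformC symA j b) => eqE.
apply: (mulfI m_neq0); lra.
Qed.

(** Multiply the inequality by j_0 and eliminate y.y with j_0^2 times the equation. The terms in j.j
    cancel, and what remains is the claim times a positive multiple of j_0 (j_0^2 + m^2). *)
Lemma susy_brane_lt : 0 < j0 -> 3 * Kr B J J F = Kr B F F F ->
  3 * Kr B J F F < Kr B J J J ->
  dot u y < dot u b / 2 - j0 * dot b b / 12.
Proof.
move=> j0_gt0 /susy_brane_eq.
have fE : pullback_part F = m *: y - m *: b.
  by rewrite /y scalerA mulfV // scale1r /v addrK.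
move: y fE => z fE; rewrite !KrE // fE -!scaleNr -/A -/b -/m -/j0 -/j /u.
rewrite !bformDl !(bformDr symA) !bformZl !(bformZr symA).
rewrite (bformC symA z b) (bformC symA j b).
have M_gt0 : 0 < m ^+ 2 by rewrite exprn_even_gt0.
move: m M_gt0 j0 j0_gt0 (dot b b) (dot b j) (dot j j) (dot b z) (dot j z) (dot z z).
move=> m' M_gt0 j0' j0_gt0 bb bj jj yb jy yy eqE ltI.
have pos : 0 < j0' * (j0' ^+ 2 + m' ^+ 2).
  by rewrite mulr_gt0 // addr_gt0 // exprn_gt0.
move: ltI; rewrite -(ltr_pM2l j0_gt0) => ltI; rewrite -subr_lt0 -(pmulr_rlt0 _ pos).
have := congr1 (fun z => z * j0' ^+ 2) eqE; lra.
Qed.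

End FluxIntersections.

(** * Choice of the threshold and summation over the stacks *)

Theorem theorem3 (R : realType) (p : nat) (B : base_data p)
    (x : {set 'I_p} -> rat) (hp : (2 <= p)%N) (hB : geometric R B)
    (hx : admissible R B x) :
  exists jstar : R, forall c : configuration R p,
    supersymmetric B c -> (forall I : 'I_p.+1, jstar <= kahler c 0 I) ->
    forall i : 'I_p,
      (nD5 c (lift ord0 i))%:R
        < 6 * T B ord0 / pair_min x + T B (lift ord0 i).
Proof.
have [C_sym c2E [t t_gt0 cone] b_ge0 K_int K_gt0 _] := hB.
have [[i0 [k0 [ik0 xminE]]] xmin_le] := pair_minP x hp.
set A := Cr R B in t_gt0 cone; pose dot := bform A.
pose e i : 'rV[R]_p := delta_mx 0 i; pose b : 'rV[R]_p := map_mx ratr (bvec B).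
have symA : A^T = A.
  by apply/matrixP => a d; rewrite !mxE -[in LHS]C_sym mxE.
pose xi i k : R := ratr (x [set i; k]).
have xi_gt0 i k : i != k -> 0 < xi i k by case/hx => x_gt0 _; rewrite ltr0q.
have dot_le i k v : i != k -> dot v v <= 2 * xi i k * dot v (e i) * dot v (e k).
  case/hx => _ [_ /(_ v)]; rewrite bform_Mpair // subr_ge0; exact.
have A_ge0 := delta_dot_ge0 hp symA xi_gt0 dot_le t_gt0 cone.
have bE i : dot b (e i) = ratr (K00 B i).
  by rewrite /dot bform_delta_r // K00E.
have br_ge0 k : 0 <= b 0 k by rewrite mxE ler0q.
have bK_gt0 k : 0 < dot b (e k) by rewrite bE ltr0q.
have c1_sqr_ge0 := c1_sqr_ge0 symA br_ge0 bK_gt0.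
pose K := 1 + \sum_k dot b (e k); pose X := 1 + \sum_i \sum_k `|2 * xi i k|.
have K_ge1 : 1 <= K by rewrite lerDl sumr_ge0 // => k _; exact: ltW.
have X_ge1 : 1 <= X by rewrite lerDl sumr_ge0 // => i _; rewrite sumr_ge0.
have xi_le i k : i != k -> 2 * xi i k <= X.
  move=> _; apply: le_trans (ler_norm _) _.
  rewrite /X (bigD1 i) //= (bigD1 k) //= -!addrA [leRHS]addrCA.
  rewrite lerDl !addr_ge0 ?sumr_ge0 //.
  by move=> l _; rewrite sumr_ge0.
have bK_le k : dot b (e k) <= K.
  rewrite /K (bigD1 k) //= addrCA lerDl addr_ge0 ?sumr_ge0 // => l _.
  exact: ltW.
have KX_ge0 : 0 <= 60 * 60 * (K * X).
  by rewrite !mulr_ge0 // (le_trans ler01).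
have sb_ge0 : 0 <= \sum_k b 0 k by rewrite sumr_ge0.
(* Each summand serves one requirement: J dominates 3600 K X, 72 c_1.c_1 and every b_k. *)
pose J := 60 * 60 * (K * X) + 72 * dot b b + \sum_k b 0 k.
have b2_ge0 : 0 <= 72 * dot b b by rewrite mulr_ge0.
have J_ge : 60 * 60 * (K * X) <= J by rewrite /J -addrA lerDl addr_ge0.
have J_geb2 : 72 * dot b b <= J by rewrite /J addrAC lerDr addr_ge0.
have J_geb k : b 0 k <= J.
  apply: (@le_trans _ _ (\sum_k b 0 k)); last by rewrite lerDr addr_ge0.
  by rewrite (bigD1 k) //= lerDl sumr_ge0.
exists J => c susy J_le i.
have [N_gt0 F_int kahler_gt0 D5 _ susyE susyL] := susy.
pose j0 := kahler c 0 ord0; pose j := pullback_part (kahler c).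
have j0_ge : J <= j0 by exact: J_le.
have j_ge k : J <= j 0 k by rewrite mxE J_le.
pose u := j + (j0 / 2) *: b.
have coord_gt0 k : 0 < u 0 k.
  exact: (coord_gt0 X_ge1 K_ge1 br_ge0 J_ge j0_ge j_ge).
pose F a : 'rV[R]_p.+1 := @fluxr R p c a; pose m a := F a 0 ord0.
pose v a := pullback_part (F a) + m a *: b; pose y a := (m a)^-1 *: v a.
pose N a : R := (@ND9 R p c a)%:R.
pose q a k := 2 * (m a * dot (v a) (e k)) - m a ^+ 2 * dot b (e k).
have D5r I : (nD5 c I)%:R - ratr (T B I)
    = \sum_a N a * Kr B (F a) (F a) (divisor R I).
  rewrite -(ratr_nat R) -rmorphB D5 rmorph_sum; apply: eq_bigr => a _.
  by rewrite rmorphM /= ratr_nat ratr_Kq map_ratr_divisor.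
have D5_0 : (nD5 c ord0)%:R - ratr (T B ord0) = \sum_a N a * dot (v a) (v a).
  by rewrite D5r; apply: eq_bigr => a _; rewrite Kr_divisor0.
have D5_S k : (nD5 c (lift ord0 k))%:R - 12 * dot b (e k) = \sum_a N a * q a k.
  have <- : ratr (T B (lift ord0 k)) = 12 * dot b (e k).
    by rewrite /T liftK rmorphM /= ratr_nat bE.
  by rewrite D5r; apply: eq_bigr => a _; rewrite Kr_divisorS.
have N_ge1 a : 1 <= N a by rewrite ler1n N_gt0.
have vE a : m a != 0 -> v a = m a *: y a.
  by move=> m0; rewrite /y scalerA mulfV // scale1r.
have uvE w : dot u w = \sum_k u 0 k * dot w (e k).
  by rewrite /dot bform_sumr.
have uqE a : \sum_k u 0 k * q a k = 2 * m a * dot u (v a) - m a ^+ 2 * dot u b.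
  rewrite !uvE !mulr_sumr -sumrB; apply: eq_bigr => k _; rewrite /q; ring.
have uqE' a : m a != 0 ->
    \sum_k u 0 k * q a k = - (m a ^+ 2 * (dot u b - 2 * dot u (y a))).
  by move=> m0; rewrite uqE vE // /dot (bformZr symA); ring.
have ltI a : m a != 0 -> dot u (y a) < dot u b / 2 - j0 * dot b b / 12.
  by move=> m0; apply: susy_brane_lt; rewrite // ?susyE ?susyL.
have j0bb_ge0 : 0 <= j0 * dot b b by rewrite mulr_ge0 // ltW ?kahler_gt0.
have uq_le0 a : \sum_k u 0 k * q a k <= 0.
  have [m0|m0] := eqVneq (m a) 0.
    by rewrite uqE m0 !(mulr0, mul0r, expr0n, subr0).
  rewrite uqE' // oppr_le0 mulr_ge0 ?sqr_ge0 //.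
  by move: (ltI a m0); move: (dot u (y a)) (dot u b) j0bb_ge0 => uy ub; lra.
(* The D5-numbers are non-negative, which bounds the sum over all stacks. Each stack contributes a
   non-positive term with weight at least 1, so the bound passes to every single stack. *)
have tadpole a : - (12 * dot u b) <= \sum_k u 0 k * q a k.
  have tot : - (12 * dot u b) <= \sum_s N s * \sum_k u 0 k * q s k.
    under eq_bigr => s _ do rewrite mulr_sumr.
    rewrite exchange_big uvE mulr_sumr -sumrN; apply: ler_sum => k _ /=.
    under eq_bigr => s _ do rewrite mulrCA.
    rewrite -mulr_sumr -D5_S mulrBr [12 * _]mulrCA lerDr.
    by rewrite mulr_ge0 // ltW.
  apply: le_trans tot _; rewrite (bigD1 a) //= -[leRHS]addr0 lerD //.
    by rewrite -[leRHS]mul1r ler_wnM2r.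
  by rewrite sumr_le0 // => s _; rewrite mulr_ge0_le0 // (le_trans ler01).
have v_int a k : m a \is a Num.int /\ dot (v a) (e k) \is a Num.int.
  have [m_int f_int] := F_int a.
  have mr_int : m a \is a Num.int by rewrite /m mxE ratr_int_num.
  split=> //; rewrite /dot bformDl bformZl -/dot bE.
  apply: rpredD; last by apply: rpredM => //; apply: ratr_int_num.
  rewrite /dot bform_delta_r //.
  have -> : \sum_l A k l * pullback_part (F a) 0 l
      = ratr (\sum_l Cq B k l * flux a 0 (lift ord0 l)).
    rewrite rmorph_sum; apply: eq_bigr => l _.
    by rewrite rmorphM /= ratr_int !mxE.
  exact: ratr_int_num.
have br a : m a != 0 -> brane A b j0 j (m a) (y a).
  move=> m0; split=> //.
  - exact: (v_int a i).1.
  - by move=> k; rewrite -bformZl -vE //; exact: (v_int a k).2.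
  - exact: susy_brane_eq.
  - exact: ltI.
  - by have := tadpole a; rewrite uqE' // lerN2.
(* If v.v were positive, all v.D_k would have one strict sign and u.v would be nonzero, against
   [susy_orthogonal]. Thus stacks with m = 0 also satisfy the cross inequality. *)
have vanish a : m a = 0 -> dot (v a) (v a) <= 0.
  move=> m0; rewrite leNgt; apply/negP.
  move=> /(timelike_same_sign hp xi_gt0 dot_le) sgn.
  have : 0 < dot u (v a) * dot (v a) (e i).
    have term k : 0 < u 0 k * dot (v a) (e k) * dot (v a) (e i).
      by rewrite -mulrA; apply: mulr_gt0 => //; apply: sgn.
    rewrite uvE mulr_suml (bigD1 i) //= ltr_pwDl // sumr_ge0 // => k _.
    exact: ltW.
  rewrite [dot u _]susy_orthogonal ?mul0r ?ltxx //.
  by rewrite gt_eqF ?kahler_gt0.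
have aE a : m a != 0 -> m a * dot (v a) (e i) = m a ^+ 2 * dot (y a) (e i).
  by move=> m0; rewrite {1}vE // /dot bformZl mulrA.
have qE a : m a != 0 -> dot (v a) (v a) = m a ^+ 2 * dot (y a) (y a).
  by move=> m0; rewrite {1 2}vE // /dot bformZl (bformZr symA) mulrA.
have m2_gt0 a : m a != 0 -> 0 < m a ^+ 2 by move=> m0; rewrite exprn_even_gt0.
have mixed a : 0 < m a * dot (v a) (e i) ->
    dot (v a) (v a) <= - (2 / 5 * ratr (pair_min x)) * (m a * dot (v a) (e i)).
  move=> a_gt0.
  have m0 : m a != 0 by apply: contraTneq a_gt0 => ->; rewrite mul0r ltxx.
  move: a_gt0; rewrite aE // qE // pmulr_rgt0 ?m2_gt0 // => yi_gt0.
  rewrite mulrCA ler_pM2l ?m2_gt0 //.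
  have [k ik] := brane_mixed_le hp symA xi_gt0 dot_le X_ge1 K_ge1 xi_le br_ge0
    bK_gt0 bK_le A_ge0 J_ge J_geb2 j0_ge j_ge (br a m0) yi_gt0.
  move=> /le_trans; apply; rewrite ler_pM2r // mulNr lerN2 ler_pM2l ?divr_gt0 //.
  by rewrite ler_rat xmin_le.
have cross a a' : 0 < m a * dot (v a) (e i) -> m a' * dot (v a') (e i) <= 0 ->
    dot (v a') (v a') * (m a * dot (v a) (e i))
    <= dot (v a) (v a) * (m a' * dot (v a') (e i)).
  move=> a_gt0 a'_le0.
  have m0 : m a != 0 by apply: contraTneq a_gt0 => ->; rewrite mul0r ltxx.
  have [m'0|m'0] := eqVneq (m a') 0.
    by rewrite m'0 mul0r mulr0 mulr_le0_ge0 ?vanish // ltW.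
  move: a_gt0 a'_le0; rewrite !aE // !qE // pmulr_rgt0 ?m2_gt0 //.
  rewrite pmulr_rle0 ?m2_gt0 // => yi_gt0 y'i_le0.
  have : dot (y a') (y a') * dot (y a) (e i) <= dot (y a) (y a) * dot (y a') (e i).
    exact: (brane_cross hp symA xi_gt0 dot_le X_ge1 K_ge1 xi_le br_ge0
    bK_gt0 bK_le A_ge0 J_ge J_geb2 J_geb j0_ge j_ge (br a m0) (br a' m'0)
    yi_gt0 y'i_le0).
  rewrite -(ler_pM2l (mulr_gt0 (m2_gt0 a m0) (m2_gt0 a' m'0))); lra.
have T0E : ratr (T B ord0) = (p + 2)%:R + 11 * dot b b :> R.
  rewrite /T unlift_none c2E rmorphD rmorphM /= ratr_int ratr_nat.
  by rewrite K000E.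
have T0_gt0 : 0 < ratr (T B ord0) :> R.
  by rewrite T0E ltr_pwDl ?mulr_ge0 // ltr0n addnS.
have xm_gt0 : 0 < ratr (pair_min x) :> R by rewrite xminE; exact: xi_gt0.
have N_ge0 a : 0 <= N a by exact: le_trans ler01 (N_ge1 a).
have key : ratr (pair_min x) * ((nD5 c (lift ord0 i))%:R - 12 * dot b (e i))
    < 6 * ratr (T B ord0).
  have [D5_le0|D5_gt0] := leP ((nD5 c (lift ord0 i))%:R - 12 * dot b (e i)) 0.
    apply: (@le_lt_trans _ _ 0); last by rewrite pmulr_rgt0.
    by rewrite pmulr_rle0.
  (* The dropped term - m^2 c_1.D_i of K(F,F,D_i) is non-positive. *)
  have half : (nD5 c (lift ord0 i))%:R - 12 * dot b (e i)
      <= 2 * \sum_a N a * (m a * dot (v a) (e i)).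
    rewrite D5_S mulr_sumr; apply: ler_sum => a _.
    rewrite mulrCA ler_wpM2l // /q gerBl mulr_ge0 ?sqr_ge0 //; exact: ltW.
  have sum_gt0 : 0 < \sum_a N a * (m a * dot (v a) (e i)).
    by have := lt_le_trans D5_gt0 half; rewrite pmulr_rgt0.
  (* With the factor 2 from [half] and the ratio 2/5 from [mixed], the left side of [key] is at most
     5 (T_0 - n_0) <= 5 T_0; as it is positive here, it lies strictly below 6 T_0. *)
  have := weighted_sum_le N_ge0 mixed cross sum_gt0.
  rewrite -D5_0.
  have n0_ge0 : 0 <= (nD5 c ord0)%:R :> R by [].
  move: (ler_wpM2l (ltW xm_gt0) half) (mulr_gt0 xm_gt0 D5_gt0); lra.
rewrite -(ltr_rat R) rmorphD rmorphM /= fmorphV rmorphM /= !ratr_nat -ltrBlDr.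
rewrite ltr_pdivlMr // mulrC.
by move: key; rewrite bE /T liftK rmorphM /= !ratr_nat.
Qed.
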